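(* Let $\mathbb{F}_q$ be the finite field with $q$ elements, let $n\ge 1$, let $R=\operatorname{map}(\mathbb{A}^n(\mathbb{F}_q),\mathbb{F}_q)$ be the finite set of all functions $\mathbb{A}^n(\mathbb{F}_q)\to\mathbb{F}_q$, and equip $R\times R$ with the uniform probability measure $P$. Let $\gamma_{q,\cup}\colon R\times R\to[0,1]$ be the random variable \[ \gamma_{q,\cup}(f,g)=\gamma_q(fg)=|V(f)\cup V(g)|/q^n . \] Then for every integer $0\le k\le q^n$, \[ P\left(\gamma_{q,\cup}=\frac{k}{q^n}\right)=\mathcal{B}\left(q^n,\frac{2q-1}{q^2},k\right). \] In particular the expectation value of $\gamma_{q,\cup}$ is \[ E(\gamma_{q,\cup})=\frac{2q-1}{q^2}=1-\left(\frac{q-1}{q}\right)^2 . \]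
   Context: $\mathbb{A}^n(\mathbb{F}_q)=\mathbb{F}_q^n$ is the set of $\mathbb{F}_q$-rational points of affine $n$-space. For $f\in R$, $V(f)=\{x\in\mathbb{A}^n(\mathbb{F}_q): f(x)=0\}$ and $\gamma_q(f)=|V(f)|/q^n$ is the fraction of zeros of $f$; $fg$ is the pointwise product. The binomial distribution is denoted $\mathcal{B}(N,p,k)=\binom{N}{k}p^k(1-p)^{N-k}$. *)

(* Defs.v *)
From HB Require Import structures.
From mathcomp Require Import all_boot all_order all_algebra.
From mathcomp Require Import all_classical all_reals all_analysis.

Set Implicit Arguments.
Unset Strict Implicit.
Unset Printing Implicit Defensive.
Import Order.TTheory GRing.Theory Num.Theory.

Local Open Scope classical_set_scope.
Local Open Scope ring_scope.

Notation affmap F n := {ffun 'rV[F]_n -> F}.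

Section ZeroFraction.
Context (F : finFieldType) (n : nat).

Definition vanishing (f : affmap F n) : {set 'rV[F]_n} :=
  [set x | f x == 0]%SET.

Definition zero_fraction (R : realType) (f : affmap F n) : R :=
  #|vanishing f|%:R / (#|F| ^ n)%:R.

Lemma zero_fraction_itv (R : realType) (f : affmap F n) :
  0 <= zero_fraction R f <= 1.
Proof.
have q0 : (0 < (#|F| ^ n)%:R :> R).
  by rewrite ltr0n expn_gt0; apply/orP; left; apply/card_gt0P; exists 0.
rewrite /zero_fraction divr_ge0//= ler_pdivrMr// mul1r ler_nat.
by rewrite -[X in (_ <= _ ^ X)%N](mul1n n) -card_mx max_card.
Qed.

(* An alias of the product type, so that it can carry the discrete
   sigma-algebra. *)
Definition map_pair : Type := (affmap F n * affmap F n)%type.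

HB.instance Definition _ := Finite.on map_pair.
HB.instance Definition _ := isPointed.Build map_pair (0, 0).
HB.instance Definition _ := @isMeasurable.Build default_measure_display
  map_pair discrete_measurable discrete_measurable0
  discrete_measurableC discrete_measurableU.

(* The second argument of [mnormalize] is only a fallback for a total mass of
   0 or +oo, which does not occur here: see [uniform_pairE]. *)
Definition uniform_pair (R : realType) : probability map_pair R :=
  mnormalize (@counting map_pair R) (dirac point).

Lemma counting_pairE (R : realType) (A : set map_pair) :
  counting A = (#|[pred x | x \in A]|%:R)%:E :> \bar R.
Proof.
rewrite /counting asboolT; last exact: finite_finset.
congr (_%:R%:E); rewrite [RHS]cardE; apply: perm_size.
apply: uniq_perm; [exact: finmap.fset_uniq|exact: enum_uniq|move=> x].
rewrite mem_enum -[in RHS]topredE/= in_fset_set//.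
exact: finite_finset.
Qed.

Lemma uniform_pairE (R : realType) (A : set map_pair) :
  uniform_pair R A = (#|[pred x | x \in A]|%:R / #|{: map_pair}|%:R)%:E.
Proof.
rewrite /uniform_pair/= /mnormalize/=.
have cT : #|[pred x : map_pair | x \in [set: map_pair]]| = #|{: map_pair}|.
  by apply: eq_card => x; rewrite inE/= in_setT.
rewrite counting_pairE cT ifF/=; first by rewrite counting_pairE.
rewrite orbF eqe pnatr_eq0; apply/negbTE; rewrite -lt0n.
by apply/card_gt0P; exists point.
Qed.

(* [*] is the pointwise product, i.e. that of the ring [{ffun _ -> F}]. *)
Definition union_fraction (R : realType) (fg : map_pair) : R :=
  zero_fraction R (fg.1 * fg.2).

Lemma measurable_union_fraction (R : realType) :
  measurable_fun setT (@union_fraction R).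
Proof. by []. Qed.

HB.instance Definition _ (R : realType) :=
  isMeasurableFun.Build _ _ _ _ (@union_fraction R)
    (@measurable_union_fraction R).

End ZeroFraction.

(* Main.v *)
(* Zipping identifies a uniform pair of maps X -> F with a uniform map
   h : X -> F * F, where X = F^n, and x is a zero of the product exactly when
   h x lies in the set of pairs with zero product, which has 2q - 1 of the q^2
   elements. Prescribing for each point whether h x lies in that set gives the
   binomial law; the expectation follows by linearity from the probability
   (2q - 1) / q^2 that a given point is a zero. *)
Require Import Defs.
From HB Require Import structures.
From mathcomp Require Import all_boot all_order all_algebra.
From mathcomp Require Import all_classical all_reals all_analysis.
From mathcomp Require Import ring.

Set Implicit Arguments.
Unset Strict Implicit.
Unset Printing Implicit Defensive.
Import Order.TTheory GRing.Theory Num.Theory.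

Local Open Scope classical_set_scope.
Local Open Scope ring_scope.

Section FiniteFunctionCount.
Context (T U : finType) (a : pred U).
Implicit Types (h : {ffun T -> U}) (S : {set T}).

Definition hits h : {set T} := [set x | a (h x)]%SET.

Lemma card_family_prod (A : T -> pred U) :
  #|family A| = (\prod_(x : T) #|A x|)%N.
Proof. by rewrite card_family foldrE big_image. Qed.

(** Once [S] is fixed the condition is pointwise: [h x] ranges freely over [a] for [x] in [S] and
    over its complement elsewhere, so these functions form a product family. *)
Lemma card_hits_eq S :
  #|[set h | hits h == S]%SET| = (#|a| ^ #|S| * #|predC a| ^ (#|T| - #|S|))%N.
Proof.
pose A x := if x \in S then a else predC a.
have -> : #|[set h | hits h == S]%SET| = #|family A|.
  apply: eq_card => h; rewrite inE; apply/eqP/familyP => [hS x|hA].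
    by rewrite /A -hS inE unfold_in; case: ifPn.
  apply/setP => x; rewrite inE; have : A x (h x) := hA x.
  by rewrite /A; case: (x \in S) => //= /negbTE.
rewrite card_family_prod (bigID (mem S))/=; congr (_ * _)%N.
  under eq_bigr => x xS do rewrite /A xS.
  by rewrite prod_nat_const.
under eq_bigr => x xS do rewrite /A (negbTE xS).
rewrite prod_nat_const -(cardC (mem S)) addKn.
by congr (_ ^ _)%N; apply: eq_card.
Qed.

Lemma card_card_hits_eq k :
  #|[set h | #|hits h| == k]%SET| =
    ('C(#|T|, k) * (#|a| ^ k * #|predC a| ^ (#|T| - k)))%N.
Proof.
rewrite -card_draws -sum1dep_card.
rewrite (partition_big hits (fun S => #|S| == k))//=.
rewrite (eq_bigr (fun=> (#|a| ^ k * #|predC a| ^ (#|T| - k))%N)).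
  by rewrite sum_nat_const; congr (_ * _)%N; apply: eq_card => S; rewrite inE.
(* With [k] replaced by [#|S|], the size condition is implied by [hits h == S] and drops out of the
   fibre. *)
move=> S /eqP <-; rewrite -card_hits_eq -sum1dep_card.
by apply: eq_bigl => h; case: (eqVneq (hits h) S) => [->|]; rewrite ?eqxx ?andbF.
Qed.

(** Only the value at [x] is constrained. The extra factor [#|U|] on the left avoids the truncated
    exponent [#|T| - 1]. *)
Lemma card_mem_hits x :
  (#|[set h | x \in hits h]%SET| * #|U| = #|a| * #|U| ^ #|T|)%N.
Proof.
pose A y := if y == x then a else predT.
have -> : #|[set h | x \in hits h]%SET| = #|family A|.
  apply: eq_card => h; rewrite !inE; apply/idP/familyP => [ax y|/(_ x)].
    by rewrite /A; case: eqP => [->|].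
  by rewrite /A eqxx.
rewrite card_family_prod (bigD1 x)//= {1}/A eqxx -mulnA; congr (_ * _)%N.
under eq_bigr => y yx do rewrite /A (negbTE yx).
by rewrite prod_nat_const (cardC1 x) -expnSr prednK//; apply/card_gt0P; exists x.
Qed.

End FiniteFunctionCount.

Section UnionFraction.
Context (F : finFieldType) (n : nat) (R : realType).
Local Notation P := (uniform_pair F n R).
Local Notation q := #|F|.

Definition map_zip (fg : map_pair F n) : {ffun 'rV[F]_n -> F * F} :=
  [ffun x => (fg.1 x, fg.2 x)].

Lemma map_zip_bij : bijective map_zip.
Proof.
exists (fun h : {ffun 'rV[F]_n -> F * F} =>
    ([ffun x => (h x).1], [ffun x => (h x).2]) : map_pair F n).
  by case=> f g; congr (_, _); apply/ffunP => x; rewrite !ffunE.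
by move=> h; apply/ffunP => x; rewrite !ffunE/= -surjective_pairing.
Qed.

(** A bijection carries the uniform measure to the uniform measure, so probabilities become counts
    of functions into [F * F]. *)
Lemma uniform_pair_map_zip (B : {set {ffun 'rV[F]_n -> F * F}}) :
  P [set fg | map_zip fg \in B] =
    (#|B|%:R / ((q ^ 2) ^ (q ^ n))%:R)%:E.
Proof.
rewrite uniform_pairE; congr (_%:R / _%:R)%:E.
  rewrite -(on_card_preimset (onW_bij _ map_zip_bij)).
  by apply: eq_card => fg; rewrite !inE; apply/asboolP/idP.
by rewrite (bij_eq_card map_zip_bij) card_ffun card_prod card_mx mul1n -mulnn.
Qed.

Definition mul_eq0 : pred (F * F) := [pred p | p.1 * p.2 == 0].

Lemma card_predC_mul_eq0 : #|predC mul_eq0| = (q.-1 ^ 2)%N.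
Proof.
rewrite -mulnn -(cardC1 (0 : F)) -cardX; apply: eq_card => p.
by rewrite !inE /mul_eq0/= mulf_eq0 negb_or.
Qed.

(** Complement count: q^2 - (q - 1)^2, taken in [R], where subtraction is not truncated. *)
Lemma card_mul_eq0 : #|mul_eq0|%:R = 2 * q%:R - 1 :> R.
Proof.
have := congr1 (fun m => m%:R : R) (cardC mul_eq0).
rewrite card_prod card_predC_mul_eq0 natrD natrX natrM => /(canRL (addrK _)) ->.
have /prednK q1 : (0 < q)%N by apply/card_gt0P; exists 0.
by rewrite -q1 -natr1; ring.
Qed.

Lemma vanishingM (f g : affmap F n) :
  vanishing (f * g) = (vanishing f :|: vanishing g)%SET.
Proof. by apply/setP => x; rewrite !inE !ffunE mulf_eq0. Qed.

Lemma vanishing_hits (fg : map_pair F n) :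
  vanishing (fg.1 * fg.2) = hits mul_eq0 (map_zip fg).
Proof. by apply/setP => x; rewrite !inE !ffunE. Qed.

Lemma natr_card_gt0 : (0 : R) < q%:R.
Proof. by rewrite ltr0n; apply/card_gt0P; exists 0. Qed.

Lemma uniform_pair_union_fraction k : (k <= q ^ n)%N ->
  P (union_fraction R @^-1` [set k%:R / (q ^ n)%:R]) =
    (binomial_pmf (q ^ n) ((2 * q%:R - 1) / q%:R ^+ 2) k)%:E.
Proof.
move=> kN; have q0 := natr_card_gt0.
have qn0 : ((q ^ n)%:R : R) != 0 by rewrite natrX expf_neq0// gt_eqF.
(* Cancelling the nonzero denominator turns the event into a condition on the size of the hit
   set. *)
have -> : union_fraction R @^-1` [set k%:R / (q ^ n)%:R] =
    [set fg : map_pair F n |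
      map_zip fg \in [set h | #|hits mul_eq0 h| == k]%SET].
  apply/seteqP; split => fg; rewrite /= inE -vanishing_hits.
    by move=> /(divIf qn0)/eqP; rewrite eqr_nat.
  by rewrite /union_fraction /zero_fraction => /eqP ->.
rewrite uniform_pair_map_zip card_card_hits_eq card_mx mul1n.
rewrite card_predC_mul_eq0 /binomial_pmf /unstable.onem; congr _%:E.
(* The failure probability is the proportion of pairs in [F * F] with nonzero product. *)
have -> : 1 - (2 * q%:R - 1) / q%:R ^+ 2 = (q.-1 ^ 2)%:R / q%:R ^+ 2 :> R.
  have /prednK q1 : (0 < q)%N by rewrite -(ltr0n R).
  rewrite natrX.
  have -> : q.-1%:R = q%:R - 1 :> R by rewrite -[in RHS]q1 -natr1 addrK.
  by field; rewrite gt_eqF.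
rewrite !natrM [in LHS]natrX card_mul_eq0 !expr_div_n -mulr_natl.
(* Splitting the exponent q^n as k + (q^n - k) distributes the total count over the success and
   failure factors. *)
rewrite -[in X in X^-1](subnKC kN) expnD natrM.
rewrite [(_ ^ (_ - k))%:R in LHS]natrX !(natrX _ (q ^ 2)) !natrX.
by rewrite invfM; ring.
Qed.

Lemma expectation_union_fraction :
  ('E_P[@union_fraction F n R] = ((2 * q%:R - 1) / q%:R ^+ 2)%:E)%E.
Proof.
have q0 := natr_card_gt0.
pose V x : set (map_pair F n) :=
  [set fg | map_zip fg \in [set h | x \in hits mul_eq0 h]%SET].
have PV x : P (V x) = ((2 * q%:R - 1) / q%:R ^+ 2)%:E.
  rewrite uniform_pair_map_zip; congr _%:E.
  have := congr1 (fun m => m%:R : R) (card_mem_hits mul_eq0 x).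
  (* [E] is the required equality of fractions, already cross-multiplied. *)
  rewrite !natrM card_mul_eq0 card_prod card_mx mul1n -mulnn natrM => E.
  apply/eqP; rewrite eqr_div; first by rewrite expr2 E.
    by rewrite natrX expf_neq0// natrM mulf_neq0 ?gt_eqF.
  by rewrite expf_neq0 ?gt_eqF.
rewrite unlock.
(* The fraction of zeros is the average over all points [x] of the indicators of the events
   [V x]. *)
transitivity (\int[P]_fg (\sum_(x : 'rV[F]_n)
    ((q ^ n)%:R^-1)%:E * (\1_(V x) fg)%:E))%E.
  apply: eq_integral => fg _.
  rewrite -ge0_sume_distrr; last by move=> x _; rewrite lee_fin.
  rewrite sumEFin -EFinM; congr _%:E.
  rewrite /union_fraction /zero_fraction mulrC vanishing_hits; congr (_ * _).
  rewrite -sum1_card natr_sum big_mkcond/=; apply: eq_bigr => x _.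
  rewrite indicE /V; case: ifPn => xfg; first by rewrite mem_set//= inE.
  by rewrite memNset//= inE; apply/negP.
rewrite ge0_integral_sum//.
rewrite (eq_bigr (fun=> ((q ^ n)%:R^-1 * ((2 * q%:R - 1) / q%:R ^+ 2))%:E)).
  (* There are q^n equal terms, which cancels the averaging factor. *)
  rewrite sumEFin sumr_const card_mx mul1n -[_ *+ _]mulr_natl.
  by rewrite mulVKf// natrX expf_neq0// gt_eqF.
move=> x _; rewrite ge0_integralZl//.
by rewrite integral_indic// setIT EFinM -(PV x).
Qed.

End UnionFraction.

Theorem proposition2p10 (R : realType) (F : finFieldType) (q n : nat)
    (hq : #|F| = q) (hn : (1 <= n)%N) :
  let P : probability (map_pair F n) R := uniform_pair F n R in
  let gamma_cup : {RV P >-> R} := @union_fraction F n R in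
  [/\ (forall f g : affmap F n,
        gamma_cup (f, g) =
          #|(vanishing f :|: vanishing g)%SET|%:R / (q ^ n)%:R),
      (forall k : nat, (k <= q ^ n)%N ->
        P (gamma_cup @^-1` [set k%:R / (q ^ n)%:R]) =
          (binomial_pmf (q ^ n) ((2 * q%:R - 1) / q%:R ^+ 2) k)%:E),
      ('E_P[gamma_cup] = ((2 * q%:R - 1) / q%:R ^+ 2)%:E)%E &
      (2 * q%:R - 1) / q%:R ^+ 2 = 1 - ((q%:R - 1) / q%:R) ^+ 2 :> R].
Proof.
subst q => P gamma_cup; split.
- by move=> f g; rewrite -vanishingM.
- exact: uniform_pair_union_fraction.
- exact: expectation_union_fraction.
- have q0 := natr_card_gt0 F R.
  by field; rewrite gt_eqF.
Qed.
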